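(* Let $A=\sigma(R)\langle x_1,\dots,x_n\rangle$ be a bijective skew PBW extension of a right Gröbner soluble ring $R$, let $m\ge1$, and fix a monomial order on $\mathrm{Mon}(A^m)$. Let $M\ne0$ be a right submodule of the free $A$-module $A^m$ and let $G$ be a finite subset of non-zero vectors of $M$. Then the following conditions are equivalent: (i) $G$ is a Gröbner basis for $M$. (ii) For any vector $\mathbf f\in A^m$: $\mathbf f\in M$ if and only if $\mathbf f\xrightarrow{G}_+\mathbf 0$. (iii) For any $\mathbf 0\ne\mathbf f\in M$ there exist $\mathbf g_1,\dots,\mathbf g_t\in G$ such that $\mathrm{lm}(\mathbf g_j)\mid\mathrm{lm}(\mathbf f)$ for $1\le j\le t$ (i.e. $\mathrm{ind}(\mathrm{lm}(\mathbf g_j))=\mathrm{ind}(\mathrm{lm}(\mathbf f))$ and there exists $\alpha_j\in\mathbb N^n$ with $\exp(\mathrm{lm}(\mathbf g_j))+\alpha_j=\exp(\mathrm{lm}(\mathbf f))$), and $\mathrm{lc}(\mathbf f)$ belongs to the right ideal of $R$ generated by $\mathrm{lc}(\mathbf g_1)c_{\mathbf g_1,\alpha_1},\dots,\mathrm{lc}(\mathbf g_t)c_{\mathbf g_t,\alpha_t}$. (iv) For every $\alpha\in\mathbb N^n$ and $1\le v\le m$, the right ideal of $R$ generated by $$\{\mathrm{lc}(\mathbf f)\mid\mathbf f\in M,\ \mathrm{ind}(\mathrm{lm}(\mathbf f))=v,\ \exp(\mathrm{lm}(\mathbf f))=\alpha\}$$ is equal to the right ideal $J_v$ of $R$ generated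 by $$\{\mathrm{lc}(\mathbf g)c_{\mathbf g,\beta}\mid\mathbf g\in G,\ \mathrm{ind}(\mathrm{lm}(\mathbf g))=v,\ \beta\in\mathbb N^n,\ \exp(\mathrm{lm}(\mathbf g))+\beta=\alpha\}.$$
   Context: **Skew PBW extensions.** Rings are associative with $1$. Let $R\subseteq A$ be rings. $A$ is a skew PBW extension of $R$, written $A=\sigma(R)\langle x_1,\dots,x_n\rangle$, if there are $x_1,\dots,x_n\in A$ such that: $A$ is a free left $R$-module with basis $\mathrm{Mon}(A)=\{x^\alpha:=x_1^{\alpha_1}\cdots x_n^{\alpha_n}\mid\alpha\in\mathbb N^n\}$; for every $i$ and $0\ne r\in R$ there is $c_{i,r}\in R\setminus\{0\}$ with $x_ir-c_{i,r}x_i\in R$; for all $i,j$ there is $c_{i,j}\in R\setminus\{0\}$ with $x_jx_i-c_{i,j}x_ix_j\in R+Rx_1+\cdots+Rx_n$. Then there are injective ring endomorphisms $\sigma_i$ of $R$ and $\sigma_i$-derivations $\delta_i$ with $x_ir=\sigma_i(r)x_i+\delta_i(r)$ for all $r\in R$. $A$ is bijective if every $\sigma_i$ is bijective and every $c_{i,j}$ is invertible. Put $|\alpha|=\alpha_1+\cdots+\alpha_n$, $\deg(x^\alpha)=|\alpha|$, $\sigma^\alpha=\sigma_1^{\alpha_1}\cdots\sigma_n^{\alpha_n}$; the degree of a non-zero $f\in A$ is the largest degree of a monomial occurring in it. For $\alpha,\beta\in\mathbb N^n$, $c_{\alpha,\beta}\in R$ is the unique element with $x^\alpha x^\beta=c_{\alpha,\beta}x^{\alpha+\beta}+p_{\alpha,\beta}$,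 where $p_{\alpha,\beta}=0$ or $\deg p_{\alpha,\beta}<|\alpha+\beta|$ (it is invertible when $A$ is bijective). **Right Gröbner soluble (RGS) ring.** $R$ is RGS if it is right Noetherian; there is an algorithm which, given $a,r_1,\dots,r_m\in R$, decides whether $a\in r_1R+\cdots+r_mR$ and, if so, finds $b_i\in R$ with $a=\sum r_ib_i$; and there is an algorithm which, given $r_1,\dots,r_m\in R$, finds a finite generating set of the right $R$-module $\{(b_1,\dots,b_m)\in R^m\mid\sum r_ib_i=0\}$. **Monomial orders.** $A^m$ is the free right $A$-module of vectors of length $m$ with canonical basis $\mathbf e_1,\dots,\mathbf e_m$; $\mathrm{Mon}(A^m)$ is the set of vectors $\mathbf X=x^\alpha\mathbf e_i$, with $\mathrm{ind}(\mathbf X)=i$, $\exp(\mathbf X)=\alpha$, $\deg(\mathbf X)=|\alpha|$. A monomial order on $\mathrm{Mon}(A^m)$ is a total order $\succeq$ such that (i) $x^{\beta+\alpha}\mathbf e_i\succeq x^\alpha\mathbf e_i$; (ii) $x^\beta\mathbf e_j\succeq x^\alpha\mathbf e_i$ implies $x^{\gamma+\beta}\mathbf e_j\succeq x^{\gamma+\alpha}\mathbf e_i$ for all $\gamma$; (iii) $\deg\mathbf X>\deg\mathbf Y$ implies $\mathbf X\succ\mathbf Y$. Each $\mathbf f\ne\mathbf 0$ in $A^m$ is uniquely $\mathbf f=c_1\mathbf X_1+\cdots+c_k\mathbf X_k$ with $c_i\in R\setminus\{0\}$ and $\mathbf X_1\succ\cdots\succ\mathbf X_k$ monomials; $\mathrm{lm}(\mathbf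 f)=\mathbf X_1$, $\mathrm{lc}(\mathbf f)=c_1$. By convention $\mathrm{lm}(\mathbf 0)=\mathbf 0$, $\mathrm{lc}(\mathbf 0)=0$, and $\mathbf X\succ\mathbf 0$ for every monomial $\mathbf X$. For $\mathbf g\ne\mathbf 0$ and $\alpha\in\mathbb N^n$, $c_{\mathbf g,\alpha}:=c_{\exp(\mathrm{lm}(\mathbf g)),\alpha}$. **Reduction.** For a finite set $F$ of non-zero vectors, $\mathbf f$ reduces to $\mathbf h$ by $F$ in one step, $\mathbf f\xrightarrow{F}\mathbf h$, if there are $\mathbf f_1,\dots,\mathbf f_t\in F$ and $r_1,\dots,r_t\in R$ such that (i) $\mathrm{lm}(\mathbf f_i)\mid\mathrm{lm}(\mathbf f)$, i.e. the indices agree and there is $\alpha_i\in\mathbb N^n$ with $\beta_i+\alpha_i=\exp(\mathrm{lm}(\mathbf f))$, $\beta_i:=\exp(\mathrm{lm}(\mathbf f_i))$; (ii) $\mathrm{lc}(\mathbf f)=\sum_{i=1}^t\mathrm{lc}(\mathbf f_i)\sigma^{\beta_i}(r_i)c_{\beta_i,\alpha_i}$; (iii) $\mathbf h=\mathbf f-\sum_{i=1}^t\mathbf f_ir_ix^{\alpha_i}$. By convention $\mathbf 0\xrightarrow{F}\mathbf 0$. $\mathbf f\xrightarrow{F}_+\mathbf h$ means that $\mathbf h$ is obtained from $\mathbf f$ by a finite chain of one-step reductions by $F$. $\mathbf f$ is reduced with respect to $F$ if $\mathbf f=\mathbf 0$ or $\mathbf f$ admits no one-step reduction by $F$; otherwise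 it is reducible. **Gröbner basis.** For a right submodule $M\ne0$ of $A^m$, a non-empty finite subset $G$ of non-zero vectors of $M$ is a Gröbner basis for $M$ if each $\mathbf 0\ne\mathbf f\in M$ is reducible with respect to $G$. $\{\mathbf 0\}$ is a Gröbner basis for $M=0$. *)

(* Defs.v *)
From Stdlib Require Export Relation_Operators.
From mathcomp Require Export all_boot all_algebra finmap.
From mathcomp Require Export boolp classical_sets.
From mathcomp Require Export mpoly.

Set Implicit Arguments.
Unset Strict Implicit.
Unset Printing Implicit Defensive.

Import GRing.Theory.
Local Open Scope ring_scope.
Local Open Scope classical_set_scope.

Definition invertible (R : pzRingType) (c : R) : Prop :=
  exists d, c * d = 1 /\ d * c = 1.

Section RightIdeals.
Variable R : pzRingType.

Definition right_ideal (I : set R) : Prop :=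
  [/\ I 0, forall a b, I a -> I b -> I (a + b) & forall a r, I a -> I (a * r)].

Definition right_ideal_gen (S : set R) : set R := smallest right_ideal S.

Definition right_noetherian : Prop :=
  forall I, right_ideal I -> exists s : seq R, I = right_ideal_gen [set` s].

Definition rdot (r b : seq R) : R := \sum_(i < size r) r`_i * b`_i.

Definition right_syz (r : seq R) : set (seq R) :=
  [set b | size b = size r /\ rdot r b = 0].

Definition right_generates (m : nat) (N : set (seq R)) (gs : seq (seq R)) : Prop :=
  (forall g, g \in gs -> N g) /\
  (forall b, N b -> exists c : seq R, size c = size gs /\
     forall i, (i < m)%N -> b`_i = \sum_(k < size gs) (nth [::] gs k)`_i * c`_k).

(* The notion of algorithm is a parameter: Alg f says that f is computed by an
   algorithm.  It may be instantiated by any model of computation, relative to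
   any representation of the elements of R. *)
Definition RGS (Alg : forall X Y : Type, (X -> Y) -> Prop) : Prop :=
  [/\ right_noetherian,
      exists2 member : R * seq R -> option (seq R),
        Alg _ _ member &
        forall (a : R) (r : seq R),
          match member (a, r) with
          | Some b => size b = size r /\ a = rdot r b
          | None => ~ exists b : seq R, size b = size r /\ a = rdot r b
          end
    & exists2 syz : seq R -> seq (seq R),
        Alg _ _ syz &
        forall r : seq R, right_generates (size r) (right_syz r) (syz r)].

End RightIdeals.

Definition xpow (A : pzRingType) (n : nat) (x : 'I_n -> A) (a : 'X_{1..n}) : A :=
  \prod_(i < n) x i ^+ a i.

(* The inclusion of R in A is the injective morphism emb, and the basis axiom
   says that every element is a unique finite left R-combination of Mon(A). *)
Record skewPBW (R A : pzRingType) (n : nat) := SkewPBW {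
  emb : {rmorphism R -> A};
  gen : 'I_n -> A;
  emb_inj : injective emb;
  pbw_basis : forall f : A, exists! c : {fsfun 'X_{1..n} -> R with 0},
    f = \sum_(a <- finsupp c) emb (c a) * xpow gen a;
  pbw_coef : forall (i : 'I_n) (r : R), r != 0 ->
    exists2 c : R, c != 0 & exists d : R, gen i * emb r - emb c * gen i = emb d;
  pbw_comm : forall i j : 'I_n,
    exists2 c : R, c != 0 &
    exists (d : R) (e : 'I_n -> R),
      gen j * gen i - emb c * gen i * gen j = emb d + \sum_(k < n) emb (e k) * gen k
}.

Section SkewPBWTheory.
Variables (R A : pzRingType) (n : nat) (P : skewPBW R A n).

Definition xmon (a : 'X_{1..n}) : A := xpow (gen P) a.

Definition coefs (f : A) : {fsfun 'X_{1..n} -> R with 0} :=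
  xget [fsfun] [set c : {fsfun 'X_{1..n} -> R with 0} |
                  f = \sum_(a <- finsupp c) emb P (c a) * xmon a].

(* Equal to 0 for f = 0. *)
Definition deg (f : A) : nat := \max_(a <- finsupp (coefs f)) mdeg a.

(* sigma_i(r) is the unique s with x_i r = s x_i + d for some d in R. *)
Definition sigma (i : 'I_n) (r : R) : R :=
  xget 0 [set s | exists d, gen P i * emb P r = emb P s * gen P i + emb P d].

Definition sigmaX (a : 'X_{1..n}) : R -> R :=
  \big[comp/id]_(i < n) iter (a i) (sigma i).

(* c_(a,b) *)
Definition cmul (a b : 'X_{1..n}) : R :=
  xget 0 [set c | exists p : A,
    xmon a * xmon b = emb P c * xmon (a + b)%MM + p /\
    (p = 0 \/ (deg p < mdeg (a + b)%MM)%N)].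

(* Over a right Noetherian ring the constants c_(i,j) are unique. *)
Definition bijective_pbw : Prop :=
  (forall i, bijective (sigma i)) /\
  (forall i j : 'I_n, exists2 c : R, invertible c &
     exists (d : R) (e : 'I_n -> R),
       gen P j * gen P i - emb P c * gen P i * gen P j
       = emb P d + \sum_(k < n) emb P (e k) * gen P k).

End SkewPBWTheory.

(* (a, i) stands for the monomial x^a e_i. *)
Definition vmon (n m : nat) : Type := ('X_{1..n} * 'I_m)%type.

Record monomial_order (n m : nat) (ge : rel (vmon n m)) : Prop := MonomialOrder {
  mo_refl : reflexive ge;
  mo_anti : antisymmetric ge;
  mo_trans : transitive ge;
  mo_total : total ge;
  mo_mul_ge : forall (a b : 'X_{1..n}) (i : 'I_m), ge ((b + a)%MM, i) (a, i);
  mo_compat : forall (a b c : 'X_{1..n}) (i j : 'I_m),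
    ge (b, j) (a, i) -> ge ((c + b)%MM, j) ((c + a)%MM, i);
  mo_deg : forall X Y : vmon n m,
    (mdeg Y.1 < mdeg X.1)%N -> ge X Y /\ X <> Y
}.

Definition rscale (A : pzRingType) (m : nat) (f : 'cV[A]_m) (a : A) : 'cV[A]_m :=
  \col_i (f i ord0 * a).

Definition right_submodule (A : pzRingType) (m : nat) (M : set 'cV[A]_m) : Prop :=
  [/\ M 0, forall f g, M f -> M g -> M (f + g) & forall f a, M f -> M (rscale f a)].

Section Groebner.
Variables (R A : pzRingType) (n m : nat) (P : skewPBW R A n) (ge : rel (vmon n m)).
Implicit Types (f g h : 'cV[A]_m) (a b : 'X_{1..n}) (F G : {fset 'cV[A]_m}).

Definition vmonE (X : vmon n m) : 'cV[A]_m := xmon P X.1 *: delta_mx X.2 ord0.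

Definition vgt : rel (vmon n m) := [rel X Y | ge X Y && (X != Y)].

(* The unique expression c_1 X_1 + ... + c_k X_k of f with nonzero c_i and
   X_1 > ... > X_k, as the list of the pairs (c_i, X_i); empty for f = 0. *)
Definition terms f : seq (R * vmon n m) :=
  xget [::] [set s : seq (R * vmon n m) |
    [/\ f = \sum_(t <- s) emb P t.1 *: vmonE t.2,
        all (fun t => t.1 != 0) s
      & sorted vgt (map snd s)]].

(* None stands for the zero vector, the leading monomial of 0. *)
Definition lm f : option (vmon n m) := ohead (map snd (terms f)).
Definition lc f : R := head 0 (map fst (terms f)).

(* exp(lm(f)) and ind(lm(f)); only meaningful for f != 0. *)
Definition lexp f : 'X_{1..n} := if lm f is Some X then X.1 else 0%MM.
Definition lind f : option 'I_m := omap snd (lm f).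

(* lm(g) | lm(f) with exp(lm(g)) + a = exp(lm(f)). *)
Definition lm_dvd g f a : Prop :=
  match lm g, lm f with
  | Some X, Some Y => X.2 = Y.2 /\ (X.1 + a)%MM = Y.1
  | _, _ => False
  end.

(* c_(g,a) *)
Definition clm g a : R := cmul P (lexp g) a.

Definition reduces1 F f h : Prop :=
  (f = 0 /\ h = 0) \/
  exists (t : nat) (g : 'I_t -> 'cV[A]_m) (r : 'I_t -> R) (a : 'I_t -> 'X_{1..n}),
    [/\ forall i, g i \in F,
        forall i, lm_dvd (g i) f (a i),
        lc f = \sum_(i < t)
                 lc (g i) * sigmaX P (lexp (g i)) (r i) * cmul P (lexp (g i)) (a i)
      & h = f - \sum_(i < t) rscale (g i) (emb P (r i) * xmon P (a i))].

Definition reduces F : 'cV[A]_m -> 'cV[A]_m -> Prop := clos_trans _ (reduces1 F).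

Definition reduced F f : Prop := f = 0 \/ ~ exists h, reduces1 F f h.

Definition reducible F f : Prop := ~ reduced F f.

Definition groebner_basis (M : set 'cV[A]_m) G : Prop :=
  (M = [set 0] /\ G = [fset 0]%fset) \/
  [/\ M <> [set 0],
      G <> fset0,
      forall g, g \in G -> M g /\ g != 0
    & forall f, M f -> f != 0 -> reducible G f].

End Groebner.

(* Main.v *)
From HB Require Import structures.
Require Import Defs.

Import GRing.Theory.
Local Open Scope ring_scope.
Local Open Scope classical_set_scope.

(** The equivalence rests on one fact about leading terms: if the leading
    monomial of g is x^b e_v with coefficient c, then g r x^a has
    coefficient c sigma^b(r) c_(b,a) at x^(a+b) e_v and no larger monomial
    ([vcoef_rscale_lead], [rscale_below]).  It holds because multiplication in A agrees, up to
    terms of smaller degree, with multiplication of twisted monomials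
    ([xmon_mul_term]), and a monomial order refines the degree.

    The degree bound goes back to x_i x^a = c x^(a + e_i) + lower terms
    ([gen_mul_xmon]).  If i is at most every index occurring in a, this is an
    equality with c = 1.  Otherwise write x^a = x_j x^a' with j the least index
    of a, exchange x_i and x_j by the commutation relation, and apply the
    induction hypothesis to x^a', whose degree is smaller.  The coefficient is a
    product of constants c_(i,j) and of their images under the sigma_j, hence
    invertible when A is bijective.

    Since c_(b,a) is invertible and sigma^b is onto, for every s there is an r
    such that sigma^b(r) c_(b,a) = c_(b,a) s, and conversely.  So the
    coefficients lc(g) sigma^b(r) c_(b,a) that a reduction step may subtract are
    exactly the right multiples of lc(g) c_(b,a), and f <> 0 can be reduced by G
    if and only if lc(f) lies in the right ideal generated by the
    lc(g) c_(g,a) with lm(g) x^a = lm(f) ([reduces1_ideal]).  This gives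
    (ii) => (iii) and (iv) => (i), and, as lc(g) c_(g,a) is itself the leading
    coefficient of g x^a in M, also (iii) => (iv).

    For (i) => (ii), a reduction step strictly lowers the leading monomial
    ([reduces1_vgt]) and stays in M; only finitely many monomials have bounded
    degree, so the order is well founded ([vgt_well_founded]) and repeated
    reduction ends at 0. *)

(** * Invertible elements and exponents *)

Section Preliminaries.
Set Implicit Arguments.
Unset Strict Implicit.
Unset Printing Implicit Defensive.

Lemma invertibleM (R : pzRingType) (c d : R) :
  invertible c -> invertible d -> invertible (c * d).
Proof.
move=> [c' [cc' c'c]] [d' [dd' d'd]]; exists (d' * c'); split.
  by rewrite mulrA -(mulrA c) dd' mulr1.
by rewrite mulrA -(mulrA d') c'c mulr1.
Qed.

Lemma invertible1 (R : pzRingType) : invertible (1 : R).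
Proof. by exists 1; rewrite mulr1. Qed.

Lemma invertible_mulIr0 (R : pzRingType) (c r : R) :
  invertible c -> (r * c == 0) = (r == 0).
Proof.
move=> [c' [cc' _]]; apply/eqP/eqP => [rc0|->]; last by rewrite mul0r.
by rewrite -(mulr1 r) -cc' mulrA rc0 mul0r.
Qed.

(** Stated for an arbitrary operation because it is used both for the ordered
    product defining x^a in A and for the composite defining sigma^a. *)
Lemma big_ord_factor (T : Type) (op : T -> T -> T) (idx : T) (n : nat)
    (f g : 'I_n -> T) (j : 'I_n) (y : T) :
  associative op -> left_id idx op ->
  (forall k : 'I_n, (k < j)%N -> f k = idx /\ g k = idx) ->
  f j = op y (g j) -> (forall k : 'I_n, (j < k)%N -> f k = g k) ->
  \big[op/idx]_(i < n) f i = op y (\big[op/idx]_(i < n) g i).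
Proof.
move=> opA op1; elim: n f g j => [|n IHn] f g j; first by case: j.
rewrite !big_ord_recl; case: (unliftP ord0 j) => [j' ->|->] lt_j eq_j gt_j.
  have [-> ->] := lt_j ord0 isT; rewrite !op1.
  by apply: (IHn _ _ j') => [k ltkj||k ltjk] //; [apply: lt_j | apply: gt_j].
rewrite eq_j -opA; congr (op _ (op _ _)).
by apply: eq_bigr => i _; apply: gt_j.
Qed.

Lemma mnmUD_neq (n : nat) (j k : 'I_n) (a : 'X_{1..n}) :
  (k : nat) != j -> (U_(j) + a)%MM k = a k.
Proof. by move=> neq_kj; rewrite mnmDE mnm1E -val_eqE /= eq_sym (negPf neq_kj). Qed.

(** Exponents are built by adding indices in decreasing order, so that each
    step U_j + a corresponds to an exact left factor x_j of the standard
    monomial, and to an outermost factor sigma_j of sigma^(U_j + a). *)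
Lemma mnm_least_ind (n : nat) (Q : 'X_{1..n} -> Prop) :
  Q 0%MM ->
  (forall (j : 'I_n) (a : 'X_{1..n}),
     (forall k : 'I_n, (k < j)%N -> a k = 0%N) -> Q a -> Q (U_(j) + a)%MM) ->
  forall a, Q a.
Proof.
move=> Q0 QS a; elim: {a}(mdeg a) {-2}a (leqnn (mdeg a)) => [|d IHd] a.
  by rewrite leqn0 mdeg_eq0 => /eqP ->.
have [->//|a0 led] := eqVneq a 0%MM.
have [i ai] : exists i, a i != 0%N.
  apply: contrapT => nex; case/eqP: a0; apply/mnmP => i; rewrite mnm0E.
  by apply/eqP/negPn/negP => ai; apply: nex; exists i.
case: (@arg_minnP _ i (fun j => a j != 0%N) (@nat_of_ord n) ai) => j aj minj.
have eqa : a = (U_(j) + (a - U_(j)))%MM by rewrite addmC submK // lep1mP.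
rewrite eqa; apply: QS => [k ltkj|].
  rewrite mnmBE [a k](_ : _ = 0%N) //; apply/eqP/negPn/negP => /minj.
  by rewrite leqNgt ltkj.
by apply: IHd; move: led; rewrite {1}eqa mdegD mdeg1.
Qed.

End Preliminaries.

(** * Coefficients, degree and multiplication in a skew PBW extension *)

Section Coefficients.
Set Implicit Arguments.
Unset Strict Implicit.
Unset Printing Implicit Defensive.
Variables (R A : pzRingType) (n : nat) (P : skewPBW R A n).
Implicit Types (a b : 'X_{1..n}) (f g : A) (r s : R).

Definition coef a f : R := coefs P f a.

Lemma coefs_spec f : f = \sum_(a <- finsupp (coefs P f)) emb P (coef a f) * xmon P a.
Proof.
have [c [fc _]] := pbw_basis P f.
exact: (@xgetI _ _ [set c0 : {fsfun 'X_{1..n} -> R with 0} |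
  f = \sum_(a <- finsupp c0) emb P (c0 a) * xmon P a] c fc).
Qed.

Lemma coefs_unique f (c : {fsfun 'X_{1..n} -> R with 0}) :
  f = \sum_(a <- finsupp c) emb P (c a) * xmon P a -> coefs P f = c.
Proof.
move=> fc; have [c0 [_ uniq_c]] := pbw_basis P f.
by rewrite -(uniq_c _ (coefs_spec f)) -(uniq_c _ fc).
Qed.

Lemma coefE f (S : {fset 'X_{1..n}}) : (finsupp (coefs P f) `<=` S)%fset ->
  f = \sum_(a <- S) emb P (coef a f) * xmon P a.
Proof.
move=> subS; rewrite -(big_fset_incl _ subS) -?coefs_spec // => a _.
by rewrite memNfinsupp => /eqP; rewrite -/(coef a f) => ->; rewrite rmorph0 mul0r.
Qed.

Lemma coef_sum (S : {fset 'X_{1..n}}) (c : 'X_{1..n} -> R) b :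
  coef b (\sum_(a <- S) emb P (c a) * xmon P a) = if b \in S then c b else 0.
Proof.
pose C : {fsfun 'X_{1..n} -> R with 0} := [fsfun a in S => c a].
have CE a : C a = if a \in S then c a else 0 by rewrite fsfunE.
rewrite /coef (@coefs_unique _ C) ?CE //.
have sub : (finsupp C `<=` S)%fset.
  by apply/fsubsetP => a; rewrite mem_finsupp CE; case: ifP; rewrite ?eqxx.
rewrite (big_fset_incl _ sub) => [|a aS]; last first.
  by rewrite memNfinsupp => /eqP ->; rewrite rmorph0 mul0r.
by apply: eq_big_seq => a aS; rewrite CE aS.
Qed.

Lemma coefB a : {morph coef a : f g / f - g}.
Proof.
move=> f g; pose S := (finsupp (coefs P f) `|` finsupp (coefs P g))%fset.
have fS := coefE (fsubsetUl _ _ : (_ `<=` S)%fset).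
have gS := coefE (fsubsetUr _ _ : (_ `<=` S)%fset).
rewrite {1}fS {1}gS -sumrB.
under eq_bigr do rewrite -mulrBl -rmorphB /=.
rewrite coef_sum; case: ifP => // /negbT; rewrite in_fsetU negb_or.
by rewrite !memNfinsupp => /andP[/eqP fa /eqP ga]; rewrite /coef fa ga subr0.
Qed.

HB.instance Definition _ a := GRing.isZmodMorphism.Build A R (coef a) (@coefB a).

Lemma coefZ a r f : coef a (emb P r * f) = r * coef a f.
Proof.
rewrite {1}(coefs_spec f) mulr_sumr.
under eq_bigr do rewrite mulrA -rmorphM /=.
rewrite coef_sum; case: ifP => // /negbT; rewrite memNfinsupp /coef => /eqP ->.
by rewrite mulr0.
Qed.

Lemma coef_xmon a b : coef b (xmon P a) = (b == a)%:R.
Proof.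
have -> : xmon P a = \sum_(d <- [fset a]%fset) emb P 1 * xmon P d.
  by rewrite big_seq_fset1 rmorph1 mul1r.
by rewrite coef_sum in_fset1; case: eqP.
Qed.

Lemma coef_term a b r : coef b (emb P r * xmon P a) = if b == a then r else 0.
Proof. by rewrite coefZ coef_xmon; case: eqP; rewrite ?mulr1 ?mulr0. Qed.

Lemma xmon0 : xmon P 0%MM = 1.
Proof. by rewrite /xmon /xpow big1 // => i _; rewrite mnm0E. Qed.

Lemma xmonU_mul (j : 'I_n) a :
  (forall k : 'I_n, (k < j)%N -> a k = 0%N) ->
  xmon P (U_(j) + a)%MM = gen P j * xmon P a.
Proof.
move=> a0; apply: (big_ord_factor (j := j)) => [||k ltkj||k ltjk].
- exact: mulrA.
- exact: mul1r.
- by rewrite mnmUD_neq ?ltn_eqF ?a0.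
- by rewrite mnmDE mnm1E eqxx add1n exprS.
- by rewrite mnmUD_neq ?gtn_eqF.
Qed.

Lemma xmonU (j : 'I_n) : xmon P U_(j)%MM = gen P j.
Proof.
rewrite -[U_(j)%MM]addm0 xmonU_mul ?xmon0 ?mulr1 // => k _; exact: mnm0E.
Qed.

Lemma embE r : emb P r = emb P r * xmon P 0%MM.
Proof. by rewrite xmon0 mulr1. Qed.

(** Reading the coefficient at x_i is what makes sigma_i(r) unique. *)
Lemma coef_term_gen (i : 'I_n) s d : coef U_(i)%MM (emb P s * gen P i + emb P d) = s.
Proof.
rewrite raddfD /= -xmonU (embE d) !coef_term eqxx.
by rewrite -mdeg_eq0 mdeg1 addr0.
Qed.

Lemma gen_mul_emb (i : 'I_n) r :
  exists d, gen P i * emb P r = emb P (sigma P i r) * gen P i + emb P d.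
Proof.
apply: (@xgetPex _ 0 [set s | exists d, gen P i * emb P r = emb P s * gen P i + emb P d]).
have [->|/(pbw_coef P i)[c _ [d eqd]]] := eqVneq r 0.
  by exists 0, 0; rewrite rmorph0 mulr0 mul0r addr0.
by exists c, d; rewrite -eqd addrC subrK.
Qed.

Lemma sigma_unique (i : 'I_n) r s d :
  gen P i * emb P r = emb P s * gen P i + emb P d -> sigma P i r = s.
Proof.
have [d' ->] := gen_mul_emb i r => /(congr1 (coef U_(i)%MM)).
by rewrite !coef_term_gen.
Qed.

Lemma sigma1 (i : 'I_n) : sigma P i 1 = 1.
Proof. by apply: (@sigma_unique _ _ _ 0); rewrite rmorph1 rmorph0 mulr1 mul1r addr0. Qed.

Lemma sigmaM (i : 'I_n) : {morph sigma P i : r s / r * s}.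
Proof.
move=> r s; have [d rd] := gen_mul_emb i r; have [e se] := gen_mul_emb i s.
apply: (@sigma_unique _ _ _ (sigma P i r * e + d * s)).
rewrite rmorphM mulrA rd mulrDl -mulrA se mulrDr !rmorphD !rmorphM /=.
by rewrite !mulrA !addrA.
Qed.

Lemma sigma_invertible (i : 'I_n) r : invertible r -> invertible (sigma P i r).
Proof.
move=> [s [rs sr]]; exists (sigma P i s).
by rewrite -!sigmaM rs sr sigma1.
Qed.

Lemma sigmaX0 r : sigmaX P 0%MM r = r.
Proof.
rewrite /sigmaX; suff -> : \big[comp/id]_(i < n) iter (0%MM i) (sigma P i) = id by [].
by elim/big_ind: _ => [//|f g -> ->//|i _]; rewrite mnm0E.
Qed.

Lemma sigmaXU_add (j : 'I_n) a r :
  (forall k : 'I_n, (k < j)%N -> a k = 0%N) ->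
  sigmaX P (U_(j) + a)%MM r = sigma P j (sigmaX P a r).
Proof.
move=> a0; rewrite /sigmaX (big_ord_factor (j := j) (y := sigma P j)
  (g := fun i => iter (a i) (sigma P i))) //.
- by move=> k ltkj; rewrite mnmUD_neq ?ltn_eqF ?a0.
- by rewrite mnmDE mnm1E eqxx add1n.
- by move=> k ltjk; rewrite mnmUD_neq ?gtn_eqF.
Qed.

(** The strict bound covers 0, also for d = 0, with no convention on its degree. *)
Definition degree_below (d : nat) f : Prop :=
  forall a, coef a f != 0 -> (mdeg a < d)%N.

Lemma degree_below0 d : degree_below d 0.
Proof. by move=> a; rewrite raddf0 eqxx. Qed.

Lemma degree_belowD d f g :
  degree_below d f -> degree_below d g -> degree_below d (f + g).
Proof.
move=> fd gd a; rewrite raddfD /=; have [->|/fd//] := eqVneq (coef a f) 0.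
by rewrite add0r => /gd.
Qed.

Lemma degree_belowZ d r f : degree_below d f -> degree_below d (emb P r * f).
Proof.
move=> fd a; rewrite coefZ => rf; apply: fd; apply: contra_neq rf => ->.
exact: mulr0.
Qed.

Lemma degree_below_leq d e f : (d <= e)%N -> degree_below d f -> degree_below e f.
Proof. by move=> le_de fd a /fd/leq_trans; apply. Qed.

Lemma degree_below_sum d (I : Type) (s : seq I) (F : I -> A) :
  (forall i, degree_below d (F i)) -> degree_below d (\sum_(i <- s) F i).
Proof.
move=> Fd; elim/big_ind: _ => // [|f g]; first exact: degree_below0.
exact: degree_belowD.
Qed.

Lemma degree_below_xmon a d : (mdeg a < d)%N -> degree_below d (xmon P a).
Proof. by move=> lt_ad b; rewrite coef_xmon; have [->//|_] := eqVneq b a; rewrite eqxx. Qed.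

Lemma degree_below_ind d (Q : A -> Prop) f :
  Q 0 -> (forall g h, Q g -> Q h -> Q (g + h)) ->
  (forall a r, (mdeg a < d)%N -> Q (emb P r * xmon P a)) ->
  degree_below d f -> Q f.
Proof.
move=> Q0 QD Qx fd; rewrite (coefs_spec f) big_seq; elim/big_ind: _ => // a.
by rewrite mem_finsupp => /fd; apply: Qx.
Qed.

Lemma degree_below_deg d f : degree_below d f -> f = 0 \/ (deg P f < d)%N.
Proof.
move=> fd; have [->|f0] := eqVneq f 0; [by left | right].
have d_gt0 : (0 < d)%N.
  rewrite lt0n; apply: contra_neq f0 => d0; move: fd; rewrite d0 => fd.
  by apply: (degree_below_ind (Q := eq^~ 0)) fd => // g h -> ->; rewrite addr0.
rewrite /deg big_seq; elim/big_ind: _ => // [x y|a].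
  by rewrite gtn_max => -> ->.
by rewrite mem_finsupp => /fd.
Qed.

Lemma deg_degree_below d f : f = 0 \/ (deg P f < d)%N -> degree_below d f.
Proof.
case=> [->|lt_fd]; first exact: degree_below0.
move=> a fa; apply: leq_ltn_trans lt_fd.
apply: (@leq_bigmax_seq _ _ xpredT) => //.
by rewrite mem_finsupp.
Qed.

Section Bijective.
Hypothesis bijP : bijective_pbw P.

(** The bound on x_j x^a is a hypothesis, and only for monomials of degree less
    than d, so that the lemma can be used inside the induction proving it. *)
Lemma gen_mul_degree_below d (j : 'I_n) f :
  (forall a, (mdeg a < d)%N -> degree_below (mdeg a).+2 (gen P j * xmon P a)) ->
  degree_below d f -> degree_below d.+1 (gen P j * f).
Proof.
move=> xd fd; apply: (degree_below_ind (Q := fun f => degree_below d.+1 (gen P j * f)))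
  fd => [|g h|a r lt_ad].
- by rewrite mulr0; apply: degree_below0.
- by rewrite mulrDr; apply: degree_belowD.
rewrite mulrA; have [e ->] := gen_mul_emb j r; rewrite mulrDl -mulrA.
apply: degree_belowD; apply: degree_belowZ.
  exact: degree_below_leq (xd _ lt_ad).
by apply: degree_below_xmon; apply: ltnW.
Qed.

(** Moving x_i into its place past x_j, the least index of the monomial, uses
    x_i x_j = c x_j x_i + e + sum_k l_k x_k.  The linear part contributes products
    x_k x^a' with x^a' of smaller degree, which is why the induction is on the
    degree and covers all the generators at once. *)
Lemma gen_mul_xmon (i : 'I_n) a :
  exists2 c, invertible c &
    degree_below (mdeg a).+1 (gen P i * xmon P a - emb P c * xmon P (U_(i) + a)%MM).
Proof.
have weaken (k : 'I_n) b :
    (exists2 c, invertible c &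
    degree_below (mdeg b).+1 (gen P k * xmon P b - emb P c * xmon P (U_(k) + b)%MM)) ->
    degree_below (mdeg b).+2 (gen P k * xmon P b).
  move=> [c _ cb]; rewrite -(subrK (emb P c * xmon P (U_(k) + b)%MM) (_ * _)).
  apply: degree_belowD; first exact: degree_below_leq cb.
  by apply: degree_belowZ; apply: degree_below_xmon; rewrite mdegD mdeg1.
elim: {a}(mdeg a).+1 {-2}a (ltnSn (mdeg a)) i => // d IHd a + i.
have exact_case b : (forall k : 'I_n, (k < i)%N -> b k = 0%N) ->
    exists2 c, invertible c &
      degree_below (mdeg b).+1 (gen P i * xmon P b - emb P c * xmon P (U_(i) + b)%MM).
  move=> b0; exists 1; first exact: invertible1.
  by rewrite xmonU_mul // rmorph1 mul1r subrr; apply: degree_below0.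
elim/mnm_least_ind: a => [|j a a0 _].
  by move=> _; apply: exact_case => k _; rewrite mnm0E.
case: (leqP i j) => [le_ij _|lt_ji].
  apply: exact_case => k lt_ki; have lt_kj := leq_trans lt_ki le_ij.
  by rewrite mnmUD_neq ?ltn_eqF ?a0.
rewrite mdegD mdeg1 add1n ltnS => lt_ad.
have [_ /(_ j i)[c invc [e [l eq_ij]]]] := bijP.
have [c' invc' qd] := IHd a lt_ad i; set q := _ - _ in qd.
have [s eq_s] := gen_mul_emb j c'.
exists (c * sigma P j c'); first exact/invertibleM/sigma_invertible.
(* q is the error term for x_i x^a'; the three groups are the derivation term
   of x_j on c', the image of q, and the linear part of the relation. *)
have -> : gen P i * xmon P (U_(j) + a)%MM
          - emb P (c * sigma P j c') * xmon P (U_(i) + (U_(j) + a))%MM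
  = emb P c * (emb P s * xmon P (U_(i) + a)%MM) + emb P c * (gen P j * q)
    + (emb P e * xmon P a + \sum_(k < n) emb P (l k) * (gen P k * xmon P a)).
  have -> : (U_(i) + (U_(j) + a) = U_(j) + (U_(i) + a))%MM by rewrite !addmA (addmC U_(i)%MM).
  rewrite (xmonU_mul (j := j) a0) (xmonU_mul (j := j) (a := (U_(i) + a)%MM)); last first.
    by move=> k lt_kj; rewrite mnmUD_neq ?ltn_eqF ?a0 // (ltn_trans lt_kj).
  have -> : \sum_(k < n) emb P (l k) * (gen P k * xmon P a)
            = (\sum_(k < n) emb P (l k) * gen P k) * xmon P a.
    by rewrite mulr_suml; apply: eq_bigr => k _; rewrite mulrA.
  rewrite -mulrDl -eq_ij !mulrBl /q mulrBr mulrBr !rmorphM !mulrA.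
  rewrite -(mulrA _ (gen P j) (emb P c')) eq_s mulrDr mulrDl !mulrA.
  set X := gen P i * _ * _; set Y := emb P c * gen P j * _ * _.
  set Z := emb P c * emb P s * _; set T := emb P c * _ * _ * _.
  rewrite opprD !addrA.
  by rewrite [Z + Y]addrC (addrAC _ _ (- Z)) addrK [Y - T]addrC addrAC addrK addrC.
apply: degree_belowD; [apply: degree_belowD|].
- do 2!apply: degree_belowZ.
  by apply: degree_below_xmon; rewrite mdegD mdeg1 add1n.
- apply: degree_belowZ; apply: gen_mul_degree_below qd => b lt_ba.
  by apply/weaken/IHd; apply: leq_trans lt_ba _.
apply: degree_belowD.
  by apply: degree_belowZ; apply: degree_below_xmon; rewrite ltnS leqnSn.
apply: degree_below_sum => k; apply: degree_belowZ.
exact/weaken/IHd.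
Qed.

Lemma gen_mul_below d (j : 'I_n) f :
  degree_below d f -> degree_below d.+1 (gen P j * f).
Proof.
apply: gen_mul_degree_below => a _; have [c _ ca] := gen_mul_xmon j a.
rewrite -(subrK (emb P c * xmon P (U_(j) + a)%MM) (_ * _)).
apply: degree_belowD; first exact: degree_below_leq ca.
by apply: degree_belowZ; apply: degree_below_xmon; rewrite mdegD mdeg1.
Qed.

Lemma xmon_mul_xmon a b :
  exists2 c, invertible c &
    degree_below (mdeg (a + b)%MM) (xmon P a * xmon P b - emb P c * xmon P (a + b)%MM).
Proof.
elim/mnm_least_ind: a => [|j a a0 [c invc cab]].
  exists 1; first exact: invertible1.
  by rewrite xmon0 rmorph1 !mul1r add0m subrr; apply: degree_below0.
have [c' invc' c'ab] := gen_mul_xmon j (a + b)%MM.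
have [s eq_s] := gen_mul_emb j c.
exists (sigma P j c * c'); first exact/invertibleM/invc'/sigma_invertible.
rewrite -addmA mdegD mdeg1 add1n xmonU_mul // -mulrA.
rewrite -[xmon P a * xmon P b](subrK (emb P c * xmon P (a + b)%MM)) mulrDr -addrA.
apply: degree_belowD; first exact: gen_mul_below.
rewrite mulrA eq_s mulrDl addrAC rmorphM -!mulrA -mulrBr.
apply: degree_belowD; apply: degree_belowZ => //.
exact: degree_below_xmon.
Qed.

Lemma xmon_mul_emb a r :
  degree_below (mdeg a) (xmon P a * emb P r - emb P (sigmaX P a r) * xmon P a).
Proof.
elim/mnm_least_ind: a => [|j a a0 IHa].
  by rewrite sigmaX0 xmon0 mul1r mulr1 subrr; apply: degree_below0.
have [s eq_s] := gen_mul_emb j (sigmaX P a r).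
rewrite mdegD mdeg1 add1n xmonU_mul // sigmaXU_add // -mulrA.
rewrite -[xmon P a * emb P r](subrK (emb P (sigmaX P a r) * xmon P a)) mulrDr -addrA.
apply: degree_belowD; first exact: gen_mul_below.
rewrite mulrA eq_s mulrDl -mulrA addrAC subrr add0r.
by apply: degree_belowZ; apply: degree_below_xmon.
Qed.

Lemma sigmaX_surj a s : exists r, sigmaX P a r = s.
Proof.
have [bij_sigma _] := bijP; move: s; rewrite /sigmaX.
elim/big_ind: _ => [s|f g f_surj g_surj s|i _ s]; first by exists s.
  have [t <-] := f_surj s; have [r <-] := g_surj t; by exists r.
elim: (a i) s => [|k IHk] s; first by exists s.
have [h _ hK] := bij_sigma i; have [r eq_r] := IHk (h s).
by exists r; rewrite iterS eq_r hK.
Qed.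

(** The constant is determined as the coefficient of x^(a+b) in x^a x^b, so the
    value chosen in the definition is the invertible one just constructed. *)
Lemma cmul_spec a b :
  invertible (cmul P a b) /\
  degree_below (mdeg (a + b)%MM)
    (xmon P a * xmon P b - emb P (cmul P a b) * xmon P (a + b)%MM).
Proof.
have [c invc cab] := xmon_mul_xmon a b.
have coef_lead s p : xmon P a * xmon P b = emb P s * xmon P (a + b)%MM + p ->
    degree_below (mdeg (a + b)%MM) p -> s = coef (a + b)%MM (xmon P a * xmon P b).
  move=> -> pab; rewrite raddfD /= coef_term eqxx.
  have [->|/pab] := eqVneq (coef (a + b)%MM p) 0; first by rewrite addr0.
  by rewrite ltnn.
suff -> : cmul P a b = c by [].
apply: xget_unique => [|s [p [eq_sp /deg_degree_below pab]]].
  exists (xmon P a * xmon P b - emb P c * xmon P (a + b)%MM).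
  by rewrite addrC subrK; split=> //; apply: degree_below_deg.
rewrite (coef_lead _ _ eq_sp pab) (coef_lead c _ _ cab) //.
by rewrite addrC subrK.
Qed.

(** Multiplication of terms is twisted monomial multiplication modulo smaller
    degree; right multiplication by x^b keeps the error of x^a r of degree less
    than |a + b|. *)
Lemma xmon_mul_term a b r :
  degree_below (mdeg (a + b)%MM) (xmon P a * (emb P r * xmon P b)
    - emb P (sigmaX P a r * cmul P a b) * xmon P (a + b)%MM).
Proof.
have [_ cab] := cmul_spec a b.
rewrite mulrA -[xmon P a * _](subrK (emb P (sigmaX P a r) * xmon P a)) mulrDl -addrA.
apply: degree_belowD; last first.
  by rewrite rmorphM -!mulrA -mulrBr; apply: degree_belowZ.
pose Q f := degree_below (mdeg (a + b)%MM) (f * xmon P b); rewrite -/(Q _).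
apply: degree_below_ind (@xmon_mul_emb a r) => [|g h|d s lt_da]; rewrite /Q.
- by rewrite mul0r; apply: degree_below0.
- by rewrite mulrDl; apply: degree_belowD.
rewrite -mulrA; apply: degree_belowZ; have [c _ cdb] := xmon_mul_xmon d b.
rewrite -(subrK (emb P c * xmon P (d + b)%MM) (_ * _)).
have lt_db : (mdeg (d + b)%MM < mdeg (a + b)%MM)%N by rewrite !mdegD ltn_add2r.
apply: degree_belowD; first exact: degree_below_leq (ltnW lt_db) cdb.
by apply: degree_belowZ; apply: degree_below_xmon.
Qed.

Lemma coef_xmon_mul_term a b r d : (mdeg (a + b)%MM <= mdeg d)%N ->
  coef d (xmon P a * (emb P r * xmon P b)) =
    if d == (a + b)%MM then sigmaX P a r * cmul P a b else 0.
Proof.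
move=> le_d; rewrite -(coef_term _ d); apply/eqP; rewrite -subr_eq0 -raddfB /=.
by apply: contraLR le_d => /xmon_mul_term; rewrite -ltnNge.
Qed.

Lemma coef_xmon_mul_term_neq0 a b r d :
  coef d (xmon P a * (emb P r * xmon P b)) != 0 ->
  d = (a + b)%MM \/ (mdeg d < mdeg (a + b)%MM)%N.
Proof.
have [le_d|] := leqP (mdeg (a + b)%MM) (mdeg d); last by right.
rewrite coef_xmon_mul_term //.
by have [-> _|_] := eqVneq d (a + b)%MM; [left | rewrite eqxx].
Qed.

End Bijective.
End Coefficients.

(** * Right ideals and right submodules *)

Section RightIdealsAndSubmodules.
Set Implicit Arguments.
Unset Strict Implicit.
Unset Printing Implicit Defensive.

Lemma right_ideal_sum (R : pzRingType) (J : set R) (I : Type) (s : seq I)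
    (F : I -> R) : right_ideal J -> (forall i, J (F i)) -> J (\sum_(i <- s) F i).
Proof. by move=> [J0 JD _] JF; elim/big_ind: _. Qed.

Lemma right_ideal_gen_ideal (R : pzRingType) (S : set R) :
  right_ideal (right_ideal_gen S).
Proof.
split=> [J [[J0 _ _] _] //|a b Sa Sb J JS|a r Sa J JS]; have [[_ JD JM] _] := JS.
  by apply: JD; [apply: Sa | apply: Sb].
by apply: JM; apply: Sa.
Qed.

Lemma right_ideal_gen_incl (R : pzRingType) (S J : set R) :
  S `<=` right_ideal_gen J -> right_ideal_gen S `<=` right_ideal_gen J.
Proof.
by move=> SJ; apply: smallest_sub SJ; apply: right_ideal_gen_ideal.
Qed.

Lemma right_ideal_genP (R : pzRingType) (S : set R) (c : R) :
  right_ideal_gen S c <->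
  exists (t : nat) (s r : 'I_t -> R), (forall i, S (s i)) /\ c = \sum_(i < t) s i * r i.
Proof.
split=> [|[t [s [r [Ss ->]]]]]; last first.
  have [_ _ SM] := right_ideal_gen_ideal S.
  apply: (right_ideal_sum _ (right_ideal_gen_ideal S)) => i.
  by apply: SM; apply: sub_gen_smallest.
pose combs : set R := [set c | exists (t : nat) (s r : 'I_t -> R),
  (forall i, S (s i)) /\ c = \sum_(i < t) s i * r i].
apply: (smallest_sub (X := combs)) => [|d Sd]; last first.
  by exists 1%N, (fun=> d), (fun=> 1); rewrite big_ord1 mulr1.
split=> [|a b [t [s [r [Ss ->]]]] [t' [s' [r' [Ss' ->]]]]|a b [t [s [r [Ss ->]]]]].
- by exists 0%N, (fun=> 0), (fun=> 0); split=> [[]//|]; rewrite big_ord0.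
- exists (t + t')%N, (fun i => match split i with inl j => s j | inr j => s' j end),
    (fun i => match split i with inl j => r j | inr j => r' j end).
  split=> [i|]; first by case: split.
  rewrite big_split_ord /=; congr (_ + _); apply: eq_bigr => i _.
    by rewrite (unsplitK (inl i)).
  by rewrite (unsplitK (inr i)).
- exists t, s, (fun i => r i * b); split=> //.
  by rewrite mulr_suml; apply: eq_bigr => i _; rewrite mulrA.
Qed.

Lemma right_submoduleB (A : pzRingType) (m : nat) (M : set 'cV[A]_m) :
  right_submodule M -> forall f g, M f -> M g -> M (f - g).
Proof.
move=> [_ MD MZ] f g Mf Mg; apply: MD => //.
suff -> : - g = rscale g (-1) by apply: MZ.
by apply/colP => i; rewrite !mxE mulrN1.
Qed.

Lemma right_submodule_sum (A : pzRingType) (m : nat) (M : set 'cV[A]_m)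
    (I : Type) (s : seq I) (F : I -> 'cV[A]_m) :
  right_submodule M -> (forall i, M (F i)) -> M (\sum_(i <- s) F i).
Proof. by move=> [M0 MD _] MF; elim/big_ind: _. Qed.

End RightIdealsAndSubmodules.

(** * Monomial orders *)

Section MonomialOrder.
Set Implicit Arguments.
Unset Strict Implicit.
Unset Printing Implicit Defensive.
Variables (n m : nat) (ge : rel (vmon n m)).
Hypothesis hge : monomial_order ge.

Lemma vgt_trans : transitive (vgt ge).
Proof.
move=> Y X Z /andP[XY neqXY] /andP[YZ _]; rewrite /vgt /= (mo_trans hge XY YZ) /=.
apply: contraNneq neqXY => eqXZ; apply/eqP/(mo_anti hge).
by rewrite XY eqXZ.
Qed.

Lemma vgt_irr X : vgt ge X X = false.
Proof. by rewrite /vgt /= eqxx andbF. Qed.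

Lemma ge_mdeg (X Y : vmon n m) : ge X Y -> (mdeg Y.1 <= mdeg X.1)%N.
Proof.
move=> XY; rewrite leqNgt; apply/negP => /(mo_deg hge)[YX]; apply.
by apply: (mo_anti hge); rewrite YX XY.
Qed.

Lemma ge_addr (X Y : vmon n m) b : ge X Y -> ge ((X.1 + b)%MM, X.2) ((Y.1 + b)%MM, Y.2).
Proof.
case: X Y => [a i] [c j] /= XY; rewrite !(addmC _ b).
exact: (mo_compat hge).
Qed.

(** A monomial below X has degree at most that of X, so the number of monomials
    of that bounded degree lying below is a decreasing measure. *)
Lemma vgt_well_founded : well_founded (fun Y X => vgt ge X Y).
Proof.
move=> X0; pose d := (mdeg X0.1).+1.
pose below X := [pred Y : 'X_{1..n < d} * 'I_m | vgt ge X (bmnm Y.1, Y.2)].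
suff acc k X : (#|below X| <= k)%N -> (mdeg X.1 < d)%N ->
    Acc (fun Y X => vgt ge X Y) X by apply: (acc #|below X0|).
elim: k X => [|k IHk] X leX ltX.
  constructor=> Y XY; exfalso; have ltY : (mdeg Y.1 < d)%N.
    by apply: leq_ltn_trans ltX; apply: ge_mdeg; case/andP: XY.
  move: leX; rewrite leqn0 => /eqP/card0_eq/(_ (BMultinom ltY, Y.2)).
  by rewrite inE /= -surjective_pairing XY.
constructor=> Y XY; have ltY : (mdeg Y.1 < d)%N.
  by apply: leq_ltn_trans ltX; apply: ge_mdeg; case/andP: XY.
apply: IHk => //; rewrite -ltnS; apply: leq_trans leX; apply: proper_card.
apply/properP; split.
  by apply/fintype.subsetP => Z; rewrite !inE; apply: vgt_trans XY.
exists (BMultinom ltY, Y.2); rewrite !inE /= -surjective_pairing ?XY //.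
by rewrite vgt_irr.
Qed.

End MonomialOrder.

(** * Leading terms of vectors *)

Section LeadingTerms.
Set Implicit Arguments.
Unset Strict Implicit.
Unset Printing Implicit Defensive.
Variables (R A : pzRingType) (n m : nat) (P : skewPBW R A n) (ge : rel (vmon n m)).
Hypothesis hge : monomial_order ge.
Implicit Types (f g h : 'cV[A]_m) (X Y Z : vmon n m) (a b : 'X_{1..n}).

Definition vcoef X f : R := coef P X.1 (f X.2 ord0).

Lemma vcoefB X : {morph vcoef X : f g / f - g}.
Proof. by move=> f g; rewrite /vcoef !mxE raddfB. Qed.

HB.instance Definition _ X := GRing.isZmodMorphism.Build 'cV[A]_m R (vcoef X) (@vcoefB X).

Lemma vcoef_term X Y r : vcoef Y (emb P r *: vmonE P X) = if Y == X then r else 0.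
Proof.
rewrite /vcoef !mxE eqxx andbT; case: X Y => [a i] [b j] /=; rewrite xpair_eqE.
case: (j == i); last by rewrite andbF !mulr0 raddf0.
by rewrite andbT mulr1 coef_term.
Qed.

Lemma vcoef_inj f g : (forall X, vcoef X f = vcoef X g) -> f = g.
Proof.
move=> fg; apply/colP => i; apply/eqP; rewrite -subr_eq0 (coefs_spec P (_ - _)).
apply/eqP/big1 => a _; rewrite raddfB /=.
by have /= := fg (a, i); rewrite /vcoef /= => ->; rewrite subrr rmorph0 mul0r.
Qed.

(** The list exists: sort the finite support of f. *)
Lemma terms_spec f :
  [/\ f = \sum_(t <- terms P ge f) emb P t.1 *: vmonE P t.2,
      all (fun t => t.1 != 0) (terms P ge f)
    & sorted (vgt ge) (map snd (terms P ge f))].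
Proof.
pose supp := [seq (a, i) | i <- enum 'I_m, a <- finsupp (coefs P (f i ord0))].
have mem_supp X : (X \in supp) = (vcoef X f != 0).
  apply/allpairsPdep/idP => [[i [a [_ fia ->]]]|fX].
    by move: fia; rewrite mem_finsupp.
  by exists X.2, X.1; rewrite mem_enum mem_finsupp -surjective_pairing.
have uniq_supp : uniq supp.
  apply: allpairs_uniq_dep => [||[i a] [j b] _ _ [-> ->]//].
    exact: enum_uniq.
  by move=> i _; apply: fset_uniq.
pose s := [seq (vcoef X f, X) | X <- sort ge supp].
have snd_s : map snd s = sort ge supp by rewrite -map_comp map_id.
apply: (@xgetI _ [::] [set s : seq (R * vmon n m) |
  [/\ f = \sum_(t <- s) emb P t.1 *: vmonE P t.2,
      all (fun t => t.1 != 0) s & sorted (vgt ge) (map snd s)]] s); split.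
- apply: vcoef_inj => Y; rewrite big_map (perm_big supp) ?perm_sort //= raddf_sum /=.
  under eq_bigr do rewrite vcoef_term.
  have [suppY|] := boolP (Y \in supp); last first.
    move=> suppNY; move: (suppNY); rewrite mem_supp negbK => /eqP ->.
    rewrite big1_seq // => X /= Xs; case: eqP => // eqYX.
    by rewrite eqYX Xs in suppNY.
  rewrite (bigD1_seq Y) //= eqxx big1 ?addr0 // => X.
  by rewrite eq_sym => /negPf ->.
- by apply/allP => t /mapP[X]; rewrite mem_sort mem_supp => fX ->.
rewrite snd_s (sorted_pairwise (vgt_trans hge)) pairwise_relI -uniq_pairwise.
rewrite sort_uniq uniq_supp andbT -(sorted_pairwise (mo_trans hge)).
exact/sort_sorted/(mo_total hge).
Qed.

(** The leading monomial in terms of coefficients alone, independent of any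
    list of terms. *)
Definition leads X f : Prop :=
  vcoef X f != 0 /\ forall Y, vcoef Y f != 0 -> ge X Y.

Lemma leads_unique X Y f : leads X f -> leads Y f -> X = Y.
Proof.
move=> [fX maxX] [fY maxY]; apply: (mo_anti hge).
by rewrite maxX // maxY.
Qed.

Lemma terms_leads f :
  match terms P ge f with
  | [::] => f = 0
  | t :: _ => leads t.2 f /\ vcoef t.2 f = t.1
  end.
Proof.
have [] := terms_spec f; case: (terms P ge f) => [|t s] /=.
  by rewrite big_nil.
move=> fE /andP[t0 _]; rewrite (path_sortedE (vgt_trans hge)) => /andP[/allP t_max _].
have supp_f Y : vcoef Y f != 0 -> Y == t.2 \/ Y \in map snd s.
  have [|sNY] := boolP (Y \in map snd s); [by right | left].
  move: H; rewrite fE big_cons raddfD raddf_sum /= vcoef_term big1_seq ?addr0.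
    by case: (Y == t.2) => //; rewrite eqxx.
  move=> u /= us; rewrite vcoef_term; case: eqP => // eqY.
  by rewrite eqY map_f in sNY.
have ft : vcoef t.2 f = t.1.
  rewrite fE big_cons raddfD raddf_sum /= vcoef_term eqxx big1_seq ?addr0 // => u /= us.
  rewrite vcoef_term; case: eqP => // eq_tu.
  by have := t_max u.2 (map_f _ us); rewrite /= -eq_tu vgt_irr.
split=> //; split=> [|Y /supp_f[/eqP->|/t_max/andP[]//]]; first by rewrite ft.
exact: (mo_refl hge).
Qed.

Lemma lmP f X : lm P ge f = Some X <-> leads X f.
Proof.
have := terms_leads f; rewrite /lm; case: (terms P ge f) => [-> | t s [lead_t _]] /=.
  by split=> // -[]; rewrite raddf0 eqxx.
by split=> [[<-]//|lead_X]; rewrite (leads_unique lead_t lead_X).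
Qed.

Lemma lcE f X : lm P ge f = Some X -> lc P ge f = vcoef X f.
Proof.
have := terms_leads f; rewrite /lm /lc; case: (terms P ge f) => //= t s [_ <-].
by case=> ->.
Qed.

Lemma lm_eq0 f : lm P ge f = None -> f = 0.
Proof. by have := terms_leads f; rewrite /lm; case: (terms P ge f). Qed.

Lemma lm_neq0 f : f != 0 -> exists X, lm P ge f = Some X.
Proof.
move=> f0; case eq_lm: (lm P ge f) => [X|]; first by exists X.
by rewrite (lm_eq0 eq_lm) eqxx in f0.
Qed.

Lemma lc_neq0 f : f != 0 -> lc P ge f != 0.
Proof. by move=> /lm_neq0[X lmX]; rewrite (lcE lmX); have /lmP[] := lmX. Qed.

Lemma lm0 : lm P ge 0 = None.
Proof.
case eq_lm: (lm P ge 0) => [X|//]; have [] := (lmP 0 X).1 eq_lm.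
by rewrite raddf0 eqxx.
Qed.

Lemma lm_ind_exp f X :
  lm P ge f = Some X <-> lind P ge f = Some X.2 /\ lexp P ge f = X.1.
Proof.
rewrite /lind /lexp; case: (lm P ge f) => [Y|] /=; last by split=> // -[].
by split=> [[->]//|[[eq2] eq1]]; rewrite [Y]surjective_pairing eq1 eq2 -surjective_pairing.
Qed.

Lemma lm_dvdE f g X b : lm P ge f = Some X ->
  lm_dvd P ge g f b <-> lind P ge g = Some X.2 /\ (lexp P ge g + b)%MM = X.1.
Proof.
move=> lmf; rewrite /lm_dvd /lind /lexp lmf; case: (lm P ge g) => [Y|] /=.
  by split=> [[-> <-]|[[->] ->]].
by split=> [|[]].
Qed.

Lemma lm_dvd_lm f g b X : lm_dvd P ge g f b -> lm P ge f = Some X ->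
  exists Y, [/\ lm P ge g = Some Y, lexp P ge g = Y.1 & X = ((Y.1 + b)%MM, Y.2)].
Proof.
rewrite /lm_dvd /lexp; case: (lm P ge g) => // Y + lmf; rewrite lmf => -[eq2 eq1].
by exists Y; rewrite eq2 eq1 -surjective_pairing.
Qed.

Hypothesis bijP : bijective_pbw P.

Lemma vcoef_rscale g r b X : vcoef X (rscale g (emb P r * xmon P b)) =
  \sum_(a <- finsupp (coefs P (g X.2 ord0)))
     vcoef (a, X.2) g * coef P X.1 (xmon P a * (emb P r * xmon P b)).
Proof.
rewrite /vcoef mxE {1}(coefs_spec P (g X.2 ord0)) mulr_suml raddf_sum /=.
by apply: eq_bigr => a _; rewrite -mulrA coefZ.
Qed.

(** A monomial of g r x^b either is x^(a+b) e_j for a monomial x^a e_j of g,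
    and compatibility applies, or has smaller degree than such a one. *)
Lemma rscale_below X g r b Z : (forall Y, vcoef Y g != 0 -> ge X Y) ->
  vcoef Z (rscale g (emb P r * xmon P b)) != 0 -> ge ((X.1 + b)%MM, X.2) Z.
Proof.
move=> maxX; apply: contraNT => geXZ; rewrite vcoef_rscale; apply/eqP/big1 => a _.
have [->|ga] := eqVneq (vcoef (a, Z.2) g) 0; first by rewrite mul0r.
have [->|/(coef_xmon_mul_term_neq0 bijP) eqZ] :=
  eqVneq (coef P Z.1 (xmon P a * (emb P r * xmon P b))) 0; first by rewrite mulr0.
case/negP: geXZ; apply: (mo_trans hge (ge_addr hge b (maxX _ ga))) => /=.
case: eqZ => [<-|lt_Z]; first by rewrite -surjective_pairing (mo_refl hge).
by have [] := mo_deg hge (X := ((a + b)%MM, Z.2)) (Y := Z) lt_Z.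
Qed.

(** No other monomial of g contributes to this coefficient: it could do so only
    through terms of lower degree, that is, if its own degree exceeded that of
    X, the greatest monomial. *)
Lemma vcoef_rscale_lead X g r b : (forall Y, vcoef Y g != 0 -> ge X Y) ->
  vcoef ((X.1 + b)%MM, X.2) (rscale g (emb P r * xmon P b)) =
    vcoef X g * (sigmaX P X.1 r * cmul P X.1 b).
Proof.
move=> maxX; rewrite vcoef_rscale /=.
have other a : a != X.1 ->
    vcoef (a, X.2) g * coef P (X.1 + b)%MM (xmon P a * (emb P r * xmon P b)) = 0.
  move=> neq_aX; have [->|/maxX/(ge_mdeg hge)/= le_a] := eqVneq (vcoef (a, X.2) g) 0.
    by rewrite mul0r.
  rewrite coef_xmon_mul_term ?(inj_eq (@addIm _ b)) //.
    by rewrite eq_sym (negPf neq_aX) mulr0.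
  by rewrite !mdegD leq_add2r.
have main : coef P (X.1 + b)%MM (xmon P X.1 * (emb P r * xmon P b))
            = sigmaX P X.1 r * cmul P X.1 b.
  by rewrite coef_xmon_mul_term ?eqxx.
have [Xg|] := boolP (X.1 \in finsupp (coefs P (g X.2 ord0))).
  rewrite (bigD1_seq X.1) ?fset_uniq //= main big1 ?addr0 -?surjective_pairing //.
rewrite memNfinsupp /= => /eqP gX; rewrite big1_seq => [|a _].
  by rewrite {1}/vcoef /coef gX mul0r.
have [->|/other//] := eqVneq a X.1.
by rewrite {1}/vcoef /coef /= gX mul0r.
Qed.

End LeadingTerms.

(** * Reduction *)

Section Reduction.
Set Implicit Arguments.
Unset Strict Implicit.
Unset Printing Implicit Defensive.
Variables (R A : pzRingType) (n m : nat) (P : skewPBW R A n) (ge : rel (vmon n m)).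
Hypothesis hge : monomial_order ge.
Hypothesis bijP : bijective_pbw P.
Variables (G : {fset 'cV[A]_m}).
Implicit Types (f g h : 'cV[A]_m) (X Y Z : vmon n m) (a b : 'X_{1..n}).

Lemma sigmaX1 a : sigmaX P a 1 = 1.
Proof.
elim/mnm_least_ind: a => [|j a a0 IHa]; first exact: sigmaX0.
by rewrite sigmaXU_add // IHa sigma1.
Qed.

Lemma lm_rscale_xmon g X b : lm P ge g = Some X ->
  lm P ge (rscale g (xmon P b)) = Some ((X.1 + b)%MM, X.2) /\
  lc P ge (rscale g (xmon P b)) = lc P ge g * clm P ge g b.
Proof.
move=> lmg; have [gX maxX] := (lmP P hge g X).1 lmg.
have coef_lead : vcoef P ((X.1 + b)%MM, X.2) (rscale g (xmon P b))
    = lc P ge g * clm P ge g b.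
  rewrite -[xmon P b]mul1r -(rmorph1 (emb P)) (vcoef_rscale_lead hge) // sigmaX1 mul1r.
  by rewrite (lcE hge lmg) /clm /lexp lmg.
have lm_gb : lm P ge (rscale g (xmon P b)) = Some ((X.1 + b)%MM, X.2).
  apply/(lmP P hge); split=> [|Y]; last first.
    by rewrite -[xmon P b]mul1r -(rmorph1 (emb P)); apply: rscale_below.
  have [inv_c _] := cmul_spec bijP (lexp P ge g) b.
  by rewrite coef_lead invertible_mulIr0 // (lcE hge lmg).
by rewrite (lcE hge lm_gb).
Qed.

(** The leading coefficients of the shifts g x^b, g in G, whose leading monomial
    is that of f. *)
Definition dividing_lcs f : set R :=
  [set c | exists g b, [/\ g \in G, lm_dvd P ge g f b & c = lc P ge g * clm P ge g b]].

(** Both directions exchange sigma^b(r) c with c s, which is possible since c is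
    invertible and sigma^b is onto. *)
Lemma reduces1_ideal f : f != 0 ->
  (exists h, reduces1 P ge G f h) <-> right_ideal_gen (dividing_lcs f) (lc P ge f).
Proof.
move=> f0; rewrite right_ideal_genP; split.
  case=> h [[f0' _]|[t [g [r [a [Gg dvd_g lc_f _]]]]]]; first by rewrite f0' eqxx in f0.
  have inv_c i := (cmul_spec bijP (lexp P ge (g i)) (a i)).1.
  have [c' cK] := choice inv_c.
  exists t, (fun i => lc P ge (g i) * clm P ge (g i) (a i)),
    (fun i => c' i * sigmaX P (lexp P ge (g i)) (r i) * cmul P (lexp P ge (g i)) (a i)).
  split=> [i|]; first by exists (g i), (a i).
  rewrite lc_f; apply: eq_bigr => i _; rewrite /clm !mulrA -(mulrA (lc _ _ _) _ (c' i)).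
  by rewrite (cK i).1 mulr1.
case=> t [s [r [Ss lc_f]]].
have [g /choice[a Ss']] := choice Ss.
have inv_c i := (cmul_spec bijP (lexp P ge (g i)) (a i)).1.
have [c' cK] := choice inv_c.
(* r' solves sigma^b(r') c = c r. *)
have [r' r'E] := choice (fun i => sigmaX_surj bijP (lexp P ge (g i))
  (cmul P (lexp P ge (g i)) (a i) * r i * c' i)).
exists (f - \sum_(i < t) rscale (g i) (emb P (r' i) * xmon P (a i))).
right; exists t, g, r', a; split=> // [i|i|]; try by have [] := Ss' i.
rewrite lc_f; apply: eq_bigr => i _; have [_ _ ->] := Ss' i.
by rewrite r'E !mulrA -[RHS]mulrA (cK i).2 mulr1.
Qed.

(** The subtracted vectors have leading monomial at most X and their
    coefficients at X add up to lc(f), so X cancels and nothing above X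
    appears. *)
Lemma reduces1_vgt f h X : lm P ge f = Some X -> reduces1 P ge G f h ->
  forall Y, vcoef P Y h != 0 -> vgt ge X Y.
Proof.
move=> lmf [[f0 _]|[t [g [r [a [_ dvd_g lc_f ->]]]]]].
  have [] := (lmP P hge f X).1 lmf.
  by rewrite f0 raddf0 eqxx.
have [_ maxX] := (lmP P hge f X).1 lmf.
have lead_g i : (forall Z, vcoef P Z (rscale (g i) (emb P (r i) * xmon P (a i))) != 0 -> ge X Z) /\
    vcoef P X (rscale (g i) (emb P (r i) * xmon P (a i)))
    = lc P ge (g i) * sigmaX P (lexp P ge (g i)) (r i) * cmul P (lexp P ge (g i)) (a i).
  have [Y [lmg expg ->]] := lm_dvd_lm (dvd_g i) lmf.
  have [_ maxY] := (lmP P hge (g i) Y).1 lmg; split=> [Z|]; first exact: rscale_below.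
  by rewrite (vcoef_rscale_lead hge) // expg (lcE hge lmg) mulrA.
have hX : vcoef P X (f - \sum_(i < t) rscale (g i) (emb P (r i) * xmon P (a i))) = 0.
  rewrite raddfB raddf_sum /= -(lcE hge lmf) lc_f.
  by under [X in _ - X]eq_bigr do rewrite (lead_g _).2; rewrite subrr.
move=> Y hY; rewrite /vgt /= andbC; apply/andP; split.
  by apply: contra_neq hY => <-.
apply: contraNT hY => geXY; rewrite raddfB raddf_sum /= big1 => [|i _]; last first.
  by apply: contraNeq geXY => /(lead_g i).1.
by rewrite subr0; apply: contraNT geXY => /maxX.
Qed.

Lemma reduces1_submodule (M : set 'cV[A]_m) f h : right_submodule M ->
  (forall g, g \in G -> M g) -> reduces1 P ge G f h -> M (f - h).
Proof.
move=> subM GM [[-> ->]|[t [g [r [a [Gg _ _ ->]]]]]].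
  by rewrite subrr; case: subM.
rewrite opprB addrC subrK; apply: right_submodule_sum => // i.
by have [_ _ MZ] := subM; apply/MZ/GM.
Qed.

Lemma reduces_submodule (M : set 'cV[A]_m) f h : right_submodule M ->
  (forall g, g \in G -> M g) -> reduces P ge G f h -> M (f - h).
Proof.
move=> subM GM; elim=> {f h} [f h|f g h _ Mfg _ Mgh].
  exact: reduces1_submodule.
by rewrite -(subrK g f) -addrA; case: subM => _ MD _; apply: MD.
Qed.

Lemma reducibleP f : f != 0 -> reducible P ge G f <-> exists h, reduces1 P ge G f h.
Proof.
move=> /eqP f0; split=> [nred|[h fh] [//|]]; last by apply; exists h.
by apply: contrapT => nex; apply: nred; right.
Qed.

(** Each step stays in M and lowers the leading monomial, and a nonzero vector
    of M admits a further step, so the chain can only end at 0. *)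
Lemma reduces_to0 (M : set 'cV[A]_m) : right_submodule M ->
  (forall g, g \in G -> M g) -> (forall f, M f -> f != 0 -> reducible P ge G f) ->
  forall f, M f -> reduces P ge G f 0.
Proof.
move=> subM GM redM f Mf; have [->|f0] := eqVneq f 0; first by apply: t_step; left.
have [X lmf] := lm_neq0 P hge f0.
elim/(well_founded_ind (vgt_well_founded hge)): X f lmf Mf f0 => X IH f lmf Mf f0.
have [h fh] := (reducibleP f0).1 (redM f Mf f0).
have [h0|h0] := eqVneq h 0; first by rewrite h0 in fh; apply: t_step.
have [Y lmh] := lm_neq0 P hge h0.
apply: t_trans (t_step _ _ _ _ fh) _; apply: (IH Y) => //.
  by apply: (reduces1_vgt lmf fh); have [] := (lmP P hge h Y).1 lmh.
have -> : h = f - (f - h) by rewrite opprB addrC subrK.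
by apply: right_submoduleB => //; apply: reduces1_submodule fh.
Qed.

Lemma reduces_first f h : reduces P ge G f h -> exists g, reduces1 P ge G f g.
Proof. by elim=> {f h} [f h fh|f g h _ [k fk]]; [exists h | exists k]. Qed.

End Reduction.
Theorem theorem4p2
  (Alg : forall X Y : Type, (X -> Y) -> Prop)
  (R A : pzRingType) (n : nat) (P : skewPBW R A n)
  (hR : RGS R Alg) (hP : bijective_pbw P)
  (m : nat) (hm : (1 <= m)%N)
  (ge : rel (vmon n m)) (hge : monomial_order ge)
  (M : set 'cV[A]_m) (hM : right_submodule M) (hM0 : M <> [set 0])
  (G : {fset 'cV[A]_m}) (hG : forall g, g \in G -> M g /\ g != 0) :
  [<-> (* i *)
       groebner_basis P ge M G;
       (* ii *)
       forall f : 'cV[A]_m, M f <-> reduces P ge G f 0;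
       (* iii *)
       forall f : 'cV[A]_m, M f -> f != 0 ->
         exists (t : nat) (g : 'I_t -> 'cV[A]_m) (a : 'I_t -> 'X_{1..n}),
           (forall j, g j \in G /\ lm_dvd P ge (g j) f (a j)) /\
           right_ideal_gen
             (range (fun j => lc P ge (g j) * clm P ge (g j) (a j))) (lc P ge f);
       (* iv *)
       forall (a : 'X_{1..n}) (v : 'I_m),
         right_ideal_gen
           [set c | exists f : 'cV[A]_m,
              [/\ M f, lind P ge f = Some v, lexp P ge f = a & c = lc P ge f]]
         = right_ideal_gen
           [set c | exists (g : 'cV[A]_m) (b : 'X_{1..n}),
              [/\ g \in G, lind P ge g = Some v, (lexp P ge g + b)%MM = a
                & c = lc P ge g * clm P ge g b]]].

Proof.
have GM g : g \in G -> M g by move=> /hG[].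
tfae.
- move=> [[]//|[_ _ _ redG]] f; split; first exact: reduces_to0.
  by move=> /(reduces_submodule hM GM); rewrite subr0.
- move=> redM f Mf f0; have /reduces_first red_f := (redM f).1 Mf.
  have /right_ideal_genP[t [s [r [Ss ->]]]] := (reduces1_ideal ge hP G f0).1 red_f.
  have [g /choice[a Ga]] := choice Ss.
  exists t, g, a; split=> [j|]; first by have [] := Ga j.
  apply/right_ideal_genP; exists t, s, r; split=> // i.
  by exists i => //=; have [_ _ ->] := Ga i.
- move=> lcM a v; apply/seteqP; split; apply: right_ideal_gen_incl => c.
    move=> [f [Mf indf expf ->]].
    have lmf : lm P ge f = Some (a, v) by apply/lm_ind_exp.
    have f0 : f != 0 by apply: contra_eq_neq lmf => ->; rewrite (lm0 P hge).
    have [t [g [b [dvd_g]]]] := lcM f Mf f0.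
    apply: right_ideal_gen_incl => _ [j _ <-].
    have [Gg /(lm_dvdE _ _ lmf)[indg expg]] := dvd_g j.
    by apply: sub_gen_smallest; exists (g j), (b j).
  (* lc(g) c_(g,b) is the leading coefficient of g x^b, which lies in M. *)
  move=> [g [b [Gg indg expg ->]]]; have [Mg g0] := hG g Gg.
  have [X lmg] := lm_neq0 P hge g0.
  have [lm_gb <-] := lm_rscale_xmon hge hP b lmg.
  apply: sub_gen_smallest; exists (rscale g (xmon P b)).
  have [-> ->] := (lm_ind_exp _ _ _ _).1 lm_gb.
  have [eqv eqa] := (lm_ind_exp _ _ _ _).1 lmg.
  by split=> //=; [case: hM => _ _; apply | rewrite -indg | rewrite -expg eqa].
- move=> lcM; right.
  have redM f : M f -> f != 0 -> exists h, reduces1 P ge G f h.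
    move=> Mf f0; apply/reduces1_ideal => //; have [X lmf] := lm_neq0 P hge f0.
    have [indf expf] := (lm_ind_exp _ _ _ _).1 lmf.
    have : right_ideal_gen [set c | exists f : 'cV[A]_m,
        [/\ M f, lind P ge f = Some X.2, lexp P ge f = X.1 & c = lc P ge f]] (lc P ge f).
      by apply: sub_gen_smallest; exists f.
    rewrite lcM; apply: right_ideal_gen_incl => c [g [b [Gg indg expg ->]]].
    by apply: sub_gen_smallest; exists g, b; split=> //; apply/(lm_dvdE _ _ lmf).
  (* G is not empty: reducing a nonzero vector by an empty set would write its
     leading coefficient as an empty sum. *)
  split=> // [G0|f Mf f0]; last exact/reducibleP/redM.
  apply: hM0; apply/seteqP; split=> [f Mf|_ ->]; last by case: hM.
  apply: contrapT => /eqP f0; have [h] := redM f Mf f0.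
  case=> [[/eqP]|[t [g [r [b [Gg _ lc_f _]]]]]]; first by rewrite (negPf f0).
  have := lc_neq0 P hge f0; rewrite lc_f big1 ?eqxx // => i _.
  by have := Gg i; rewrite G0.
Qed.
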